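(* Let $n\ge d$, $L=\{\ell_1,\dots,\ell_n\}$, $R=\{r_1,\dots,r_d\}$, and let $\mathcal{M}$ be a linkage $(n,d)$-matching field on $L\sqcup R$. For every $v\in\mathbb{Z}_{>0}^d$ with $v_1+\dots+v_d=n$ there exists a maximal tope with right degree vector $v$ that is compatible with (every matching of) $\mathcal{M}$, and it is the unique tope with right degree vector $v$ compatible with $\mathcal{M}$.
   Context: Graphs are bipartite graphs on $L\sqcup R$ identified with edge sets; the right degree vector is $(\deg r_1,\dots,\deg r_d)$. A maximal tope is a graph in which every node of $L$ has degree exactly $1$ and every node of $R$ has positive degree. Two graphs $F_1,F_2$ are compatible if for all $J\subseteq L$, $I\subseteq R$ such that both contain a perfect matching between $J$ and $I$, these perfect matchings are equal. An $(n,d)$-matching field $\mathcal{M}=(M_\sigma)$ assigns to each $d$-subset $\sigma\subseteq L$ a perfect matching $M_\sigma$ between $\sigma$ and $R$; it is linkage if for every $r_i\in R$ and every $(d+1)$-subset $\tau\subseteq L$ there exist distinct $\ell_j,\ell_{j'}\in\tau$ such that $M_{\tau\setminus\{\ell_j\}}$ and $M_{\tau\setminus\{\ell_{j'}\}}$ agree everywhere except on the edges incident with $r_i$. *)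

(* Defs.v *)
(* L = 'I_n (nodes l_1..l_n), R = 'I_d (nodes r_1..r_d).
   A bipartite graph on L ⊔ R is identified with its edge set {set 'I_n * 'I_d}. *)
From mathcomp Require Import all_boot all_order.
Set Implicit Arguments. Unset Strict Implicit. Unset Printing Implicit Defensive.

Definition graph (n d : nat) := {set 'I_n * 'I_d}.

Definition ldeg n d (G : graph n d) (l : 'I_n) : nat := #|[set e in G | e.1 == l]|.
Definition rdeg n d (G : graph n d) (r : 'I_d) : nat := #|[set e in G | e.2 == r]|.

Definition maximal_tope n d (G : graph n d) : Prop :=
  (forall l, ldeg G l = 1) /\ (forall r, 0 < rdeg G r).

Definition perfect_matching n d (J : {set 'I_n}) (I : {set 'I_d}) (P : graph n d) : Prop :=
  [/\ forall e, e \in P -> (e.1 \in J) && (e.2 \in I),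
      forall l, l \in J -> #|[set e in P | e.1 == l]| = 1
    & forall r, r \in I -> #|[set e in P | e.2 == r]| = 1].

Definition compatible n d (F1 F2 : graph n d) : Prop :=
  forall (J : {set 'I_n}) (I : {set 'I_d}) (P1 P2 : graph n d),
    perfect_matching J I P1 -> P1 \subset F1 ->
    perfect_matching J I P2 -> P2 \subset F2 -> P1 = P2.

Definition matching_field n d (M : {set 'I_n} -> graph n d) : Prop :=
  forall sigma : {set 'I_n}, #|sigma| = d -> perfect_matching sigma [set: 'I_d] (M sigma).

Definition linkage n d (M : {set 'I_n} -> graph n d) : Prop :=
  forall (r : 'I_d) (tau : {set 'I_n}), #|tau| = d.+1 ->
    exists j j' : 'I_n, [/\ j \in tau, j' \in tau, j != j' &
      [set e in M (tau :\ j) | e.2 != r] = [set e in M (tau :\ j') | e.2 != r]].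

Definition compatible_with_field n d (M : {set 'I_n} -> graph n d) (F : graph n d) : Prop :=
  forall sigma : {set 'I_n}, #|sigma| = d -> compatible F (M sigma).

(* Main.v *)
Require Import Defs.
From mathcomp Require Import all_boot all_order.
From mathcomp Require Import zify.
Set Implicit Arguments. Unset Strict Implicit. Unset Printing Implicit Defensive.

(* A tope is a function f : L -> R; a tope field of type v assigns to every set s
   with as many points as the sum of v a function on s with fibre sizes v, and a
   matching field is a tope field of type (1,...,1).  If t has one more point, the
   linkage property says that the fibres over r of the topes on t \ {x}, for x in t,
   together cover only v_r + 1 points; sending these points to r gives a tope on t
   of type v + e_r (amalgamation).  This field is linkage again and amalgamations
   commute, so one obtains a tope f_v on L for every positive v, and each M_sigma
   is contained in some f_w.

   Topes f and g are compatible iff the digraph on R with the arcs f l -> g l has no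
   cycle of length at least 2.  Consider f_v and f_w with a cycle and with
   sum_r (v_r - w_r)^+ minimal.  For fixed u the topes f_(u + e_r) are connected to
   each other by moves of a single point, so a unit of v at a node with v_r > w_r
   that is not reached from a cycle can be moved, without destroying cycles, until it
   is reached from one.  Once all nodes with v_r > w_r are reached from cycles, a unit
   of w at a node with v_r < w_r can be moved step by step to a node with v_r > w_r;
   counting arcs shows that the nodes with v_r > w_r stay reached from cycles.  The
   last step makes the sum smaller, a contradiction.

   For uniqueness, a section of f is a matching of M by compatibility, and if f' has
   the same fibre sizes as f and differs from it, then f' violates compatibility with
   the matching given by a section choosing points on which f and f' differ. *)

(** * Cycles in the digraph of arcs [f l -> g l] *)

Section Cycles.
Variable R : finType.
Implicit Types E : rel R.

(** Loops do not count as cycles: in the digraph of two topes they come from points on which the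
    topes agree. *)
Definition on_cycle E a := [exists b, [&& a != b, connect E a b & connect E b a]].
Definition fed E t := [exists a, on_cycle E a && connect E a t].

Lemma fedP E t :
  reflect (exists a b, [/\ a != b, connect E a b, connect E b a & connect E a t])
          (fed E t).
Proof.
apply: (iffP existsP) => [[a /andP[/existsP[b /and3P[ab c1 c2]] c3]]|[a [b [ab c1 c2 c3]]]].
  by exists a, b.
by exists a; rewrite c3 andbT; apply/existsP; exists b; rewrite ab c1.
Qed.

Lemma fed_mono E E' t : subrel (connect E) (connect E') -> fed E t -> fed E' t.
Proof.
move=> sub /fedP[a [b [ab c1 c2 c3]]].
by apply/fedP; exists a, b; split=> //; apply: sub.
Qed.

Lemma fed_connect E t t' : fed E t -> connect E t t' -> fed E t'.
Proof.
move=> /fedP[a [b [ab c1 c2 c3]]] c; apply/fedP; exists a, b; split=> //.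
exact: connect_trans c.
Qed.

End Cycles.

Section Arcs.
Variables L R : finType.

(** Each point of [P] contributes one arc, so [predC1 e] deletes the arc of the point [e] while
    parallel arcs of other points stay. *)
Definition arcs (P : pred L) (f g : L -> R) : rel R :=
  fun a b => [exists l, [&& P l, f l == a & g l == b]].

Lemma arcsI (P : pred L) (f g : L -> R) l : P l -> connect (arcs P f g) (f l) (g l).
Proof. by move=> Pl; apply/connect1/existsP; exists l; rewrite Pl !eqxx. Qed.

Lemma arcs_sub (P Q : pred L) (f g : L -> R) :
  subpred P Q -> subrel (connect (arcs P f g)) (connect (arcs Q f g)).
Proof.
move=> PQ; apply: connect_sub => a b /existsP[l /and3P[/PQ Ql fl gl]].
by apply/connect1/existsP; exists l; rewrite Ql fl.
Qed.

Lemma arcs_eq (P : pred L) (f g f' g' : L -> R) :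
  (forall l, P l -> f l = f' l) -> (forall l, P l -> g l = g' l) ->
  subrel (connect (arcs P f g)) (connect (arcs P f' g')).
Proof.
move=> ff gg; apply: connect_sub => a b /existsP[l /and3P[Pl /eqP<- /eqP<-]].
by rewrite ff // gg //; apply: arcsI.
Qed.

(** Cut a path before its first and after its last use of [e]. *)
Lemma connect_arcs_split (e : L) (f g : L -> R) a b :
  connect (arcs predT f g) a b ->
  connect (arcs (predC1 e) f g) a b \/
  connect (arcs (predC1 e) f g) a (f e) /\ connect (arcs (predC1 e) f g) (g e) b.
Proof.
move=> /connectP[p]; elim: p a => [|c p IHp] a /=; first by move=> _ ->; left.
case/andP=> /existsP[l /and3P[_ /eqP fl /eqP gl]] pc lastb.
have [IH|[IH1 IH2]] := IHp c pc lastb; case: (eqVneq l e) => [le|nle].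
- by right; subst l; rewrite -fl -gl in IH *; split.
- by left; apply: connect_trans IH; rewrite -fl -gl; apply: arcsI.
- by right; subst l; rewrite -fl; split.
- right; split=> //; apply: connect_trans IH1; rewrite -fl -gl; exact: arcsI.
Qed.

(* Every cycle that uses the arc [e] passes through both ends of [e], so an
   element fed by a cycle is fed without [e] or reachable from the head of [e]. *)
Lemma fed_delete (e : L) (f g : L -> R) t :
  fed (arcs predT f g) t ->
  fed (arcs (predC1 e) f g) t \/ connect (arcs (predC1 e) f g) (g e) t.
Proof.
move=> /fedP[a [b [ab c1 c2 c3]]].
have [c3'|[_ ?]] := connect_arcs_split e c3; last by right.
have [c1'|[_ c1']] := connect_arcs_split e c1; have [c2'|[_ c2']] := connect_arcs_split e c2.
- by left; apply/fedP; exists a, b.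
- by right; apply: connect_trans c3'.
- by right; apply: connect_trans c3'; apply: connect_trans c2'.
- by right; apply: connect_trans c3'.
Qed.

(* Moving the tail of an arc away from an unfed node destroys no cycle and no
   path leaving a cycle. *)
Lemma fed_move_tail (e : L) (f f' g : L -> R) t :
  (forall l, l != e -> f l = f' l) -> ~~ fed (arcs predT f g) (f e) ->
  fed (arcs predT f g) t -> fed (arcs predT f' g) t.
Proof.
move=> ff' nfe /fedP[a [b [ab c1 c2 c3]]].
have key c : connect (arcs predT f g) a c -> connect (arcs (predC1 e) f g) a c.
  case/(connect_arcs_split e)=> // -[afe _]; case/negP: nfe; apply/fedP.
  by exists a, b; split=> //; apply: arcs_sub afe.
have to c d : connect (arcs (predC1 e) f g) c d -> connect (arcs predT f' g) c d.
  move=> /(arcs_eq (f' := f') (g' := g)) cd; apply: (@arcs_sub (predC1 e)) => //.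
  exact: cd.
apply/fedP; exists a, b; split=> //; try exact/to/key.
have [c2'|[c2' _]] := connect_arcs_split e c2; first exact: to.
case/negP: nfe; apply/fedP; exists a, b; split=> //.
by apply: connect_trans c1 _; apply: arcs_sub c2'.
Qed.

(* The head of the arc [e] may be moved away from a node [r] with more incoming
   than outgoing arcs: if some [t] became unfed, the set [B] of nodes leading to
   [r] would have more incoming than outgoing arcs, although [t] is reached from
   [r], hence from [B], along an arc leaving [B]. *)
Lemma fed_move_head (e : L) (f g g' : L -> R) (X : {set R}) :
  (forall l, l != e -> g l = g' l) ->
  (forall r, r \notin X -> #|[set l | f l == r]| <= #|[set l | g l == r]|) ->
  #|[set l | f l == g e]| < #|[set l | g l == g e]| -> g e \notin X ->
  (forall t, t \in X -> fed (arcs predT f g) t) ->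
  forall t, t \in X -> fed (arcs predT f g') t.
Proof.
move=> gg' leX ltr rX fedX t tX; set r := g e in ltr rX *.
set D' := arcs (predC1 e) f g.
suff: fed D' t.
  apply: fed_mono => a b ab; apply: (@arcs_sub (predC1 e)) => //.
  exact: (arcs_eq (f' := f) (g' := g')) ab.
case: (boolP (fed D' t)) => // nft; exfalso.
have fedX' u : u \in X -> fed D' u \/ connect D' r u by move/fedX/(fed_delete e).
have rt : connect D' r t by case: (fedX' t tX) => [ft|//]; case/negP: nft.
have nfr : ~~ fed D' r by apply: contra nft => /fed_connect; apply.
pose B := [set b | connect D' b r].
have BX b : b \in B -> b \notin X.
  rewrite inE => br; apply/negP => bX; case/negP: nfr.
  case: (fedX' b bX) => [fb|rb]; first exact: fed_connect br.
  apply/fedP; exists r, b; split=> //.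
  by apply: contraNneq rX => ->.
have rB : r \in B by rewrite inE.
have tB : t \notin B by apply: contraTN tX => /BX.
have count (h : L -> R) : \sum_(b in B) #|[set l | h l == b]| = #|[set l | h l \in B]|.
  rewrite -sum1_card (partition_big h (mem B)) /=; last by move=> l; rewrite inE.
  apply: eq_bigr => b bB; rewrite -sum1_card; apply: eq_bigl => l.
  by rewrite !in_set; case: eqP => [->|]; rewrite ?andbF // andbT -[LHS]bB inE.
have lt : #|[set l | f l \in B]| < #|[set l | g l \in B]|.
  rewrite -!count (bigD1 r rB) [X in _ < X](bigD1 r rB) /= -addSn leq_add //.
  by apply: leq_sum => b /andP[/BX bX _]; apply: leX.
have sub : [set l | g l \in B] :\ e \subset [set l | f l \in B].
  apply/subsetP => l; rewrite !inE => /andP[le gl].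
  by apply: connect_trans gl; apply: arcsI.
have eB : e \in [set l | g l \in B] by rewrite inE.
have eqs : [set l | g l \in B] :\ e = [set l | f l \in B].
  by apply/eqP; rewrite eqEcard sub /=; move: lt; rewrite (cardsD1 e [set l | g l \in B]) eB; lia.
have clB a b : D' a b -> a \in B -> b \in B.
  case/existsP=> l /and3P[le /eqP <- /eqP <-] fB.
  have fl : l \in [set l | f l \in B] by rewrite in_set.
  by move: fl; rewrite -eqs in_setD1 in_set => /andP[].
case/negP: tB; have /connectP[p] := rt; elim: p {rt} (r) rB => [|c p IHp] a aB /=.
  by move=> _ ->.
by case/andP=> ac; apply: IHp; apply: clB aB.
Qed.

End Arcs.

(** * Absence of cycles between topes connected by single moves *)

Section Excess.
Variable R : finType.
Implicit Types s u : seq R.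

Lemma sum_count_mem s : \sum_r count_mem r s = size s.
Proof.
elim: s => [|x s IHs] /=; first by rewrite big1.
by rewrite big_split /= IHs (bigD1 x) //= eqxx big1 // => r /negPf; rewrite eq_sym => ->.
Qed.

(** Truncated subtraction makes this a sum of positive parts. Below, [s] encodes the degree vector
    with entries [(count_mem r s).+1]. *)
Definition excess s s' := \sum_r (count_mem r s - count_mem r s').

Lemma sum_change (P : pred R) r (a b : R -> nat) : P r ->
  (forall t, t != r -> a t = b t) -> \sum_(t | P t) a t + b r = \sum_(t | P t) b t + a r.
Proof.
move=> Pr ab; rewrite (bigD1 r) // [in RHS](bigD1 r) //=.
rewrite (eq_bigr b) => [|t /andP[_ /ab]] //; lia.
Qed.

Lemma excess_consl r u s' :
  excess (r :: u) s' = excess u s' + (count_mem r s' <= count_mem r u).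
Proof.
rewrite /excess; have eqc t : t != r -> count_mem t (r :: u) = count_mem t u.
  by move=> /negPf tr; rewrite /= eq_sym tr.
have /= := @sum_change predT r (fun t => count_mem t (r :: u) - count_mem t s')
  (fun t => count_mem t u - count_mem t s') isT
  (fun t tr => congr1 (subn^~ (count_mem t s')) (eqc t tr)).
by rewrite eqxx; case: leqP; lia.
Qed.

Lemma excess_consr s r u :
  excess s (r :: u) + (count_mem r u < count_mem r s) = excess s u.
Proof.
rewrite /excess; have eqc t : t != r -> count_mem t (r :: u) = count_mem t u.
  by move=> /negPf tr; rewrite /= eq_sym tr.
have /= := @sum_change predT r (fun t => count_mem t s - count_mem t (r :: u))
  (fun t => count_mem t s - count_mem t u) isT
  (fun t tr => congr1 (subn (count_mem t s)) (eqc t tr)).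
by rewrite eqxx; case: ltnP; lia.
Qed.

Lemma excess_eq0 s s' : size s = size s' -> excess s s' = 0 -> perm_eq s s'.
Proof.
move=> ss /eqP; rewrite /excess sum_nat_eq0 => /forallP le.
have le' r : count_mem r s <= count_mem r s' by have := le r; rewrite subn_eq0.
have /eqP : \sum_r (count_mem r s' - count_mem r s) = 0.
  by rewrite sumnB // !sum_count_mem ss subnn.
rewrite sum_nat_eq0 => /forallP ge; rewrite /perm_eq; apply/allP => r _ /=.
by rewrite eqn_leq le' /=; have := ge r; rewrite subn_eq0.
Qed.

Lemma excess_lt s s' : size s = size s' -> 0 < excess s s' ->
  exists r, count_mem r s < count_mem r s'.
Proof.
move=> ss lt; apply/existsP; apply: contraTT lt => /existsPn ge.
rewrite -eqn0Ngt; apply/eqP; rewrite /excess sumnB => [|r _]; last by rewrite leqNgt.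
by rewrite !sum_count_mem ss subnn.
Qed.

Lemma excess_gt s s' : 0 < excess s s' -> exists r, count_mem r s' < count_mem r s.
Proof.
move=> lt; apply/existsP; apply: contraTT lt => /existsPn ge.
rewrite -eqn0Ngt /excess sum_nat_eq0; apply/forallP => r; rewrite /= subn_eq0.
by rewrite leqNgt.
Qed.

Lemma connect_ind (E : rel R) (P : R -> Prop) :
  (forall a b, E a b -> P a -> P b) -> forall a b, connect E a b -> P a -> P b.
Proof.
move=> step a b /connectP[p]; elim: p a => [|c p IHp] a /=; first by move=> _ ->.
by case/andP=> ac pc lb Pa; apply: (IHp c pc lb); apply: step Pa.
Qed.

End Excess.

Section Global.
Variables (L R : finType) (N : nat) (f : seq R -> {ffun L -> R}).

Definition neighbour u : rel R := fun r r' =>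
  [exists e, [&& f (r :: u) e == r, f (r' :: u) e == r' &
    [forall l, (l != e) ==> (f (r :: u) l == f (r' :: u) l)]]].

Hypothesis card_fibre : forall s r, size s = N ->
  #|[set l | f s l == r]| = (count_mem r s).+1.
Hypothesis f_perm : forall s s', size s = N -> perm_eq s s' -> f s = f s'.
Hypothesis f_conn : forall u r r', (size u).+1 = N -> connect (neighbour u) r r'.

Let D s s' := arcs predT (f s) (f s').

Definition unfed_excess s s' :=
  \sum_(t | ~~ fed (D s s') t) (count_mem t s - count_mem t s').

Lemma neighbourP u r r' : neighbour u r r' ->
  exists e, [/\ f (r :: u) e = r, f (r' :: u) e = r' &
               forall l, l != e -> f (r :: u) l = f (r' :: u) l].
Proof.
case/existsP=> e /and3P[/eqP er /eqP er' /forallP eq]; exists e; split=> // l le.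
by apply/eqP; apply: implyP (eq l) le.
Qed.

(** Lexicographic induction on [excess] and then [unfed_excess], with [s'] fixed in the inner
    induction. If the excess is 0, the two topes coincide and all arcs are loops. *)
Lemma no_cycle s s' : size s = N -> size s' = N -> forall t, ~~ fed (D s s') t.
Proof.
move: {2}(excess s s') (leqnn (excess s s')) => m.
elim/ltn_ind: m s s' => m IHm s s' lem ss ss'.
have [ltm|eqm] := ltnP (excess s s') m; first exact: (IHm _ ltm).
have {eqm lem}eqm : excess s s' = m by apply/eqP; rewrite eqn_leq lem.
have [m0|m_gt0] := posnP m.
  move=> t; have /(f_perm ss) fss' : perm_eq s s'.
    by apply: excess_eq0; rewrite ?ss ?eqm.
  apply/negP => /fedP[a [b [/eqP ab cab _ _]]]; case: ab.
  apply: (connect_ind (P := fun b => a = b) _ cab) => // x y /existsP[l].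
  by rewrite fss' => /and3P[_ /eqP -> /eqP ->].
move: {2}(unfed_excess s s') (leqnn (unfed_excess s s')) => k.
elim/ltn_ind: k s ss eqm => k IHk s ss eqm lek t0; apply/negP => fed0.
have [[t /andP[nft xt]]|allfed] :
    (exists t, ~~ fed (D s s') t && (count_mem t s' < count_mem t s)) \/
    (forall t, count_mem t s' < count_mem t s -> fed (D s s') t).
  have [/existsP|/existsPn H] := boolP [exists t, ~~ fed (D s s') t &&
    (count_mem t s' < count_mem t s)]; [by left | right=> t xt].
  by have := H t; rewrite xt andbT negbK.
- (* A unit of excess at an unfed node [t] is moved along the neighbour relation
     towards a node [y0] in deficit, until it is fed or the excess drops. *)
  have ts : t \in s by rewrite -has_pred1 has_count; apply: leq_ltn_trans xt.
  have [u su] : exists u, perm_eq s (t :: u) by exists (rem t s); apply: perm_to_rem.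
  have szu : (size u).+1 = N by rewrite -ss (perm_size su).
  have cs r : count_mem r s = count_mem r (t :: u) by apply/permP.
  have [y0 y0lt] : exists r, count_mem r s < count_mem r s'.
    by apply: excess_lt; rewrite ?ss // eqm.
  have exu : excess (t :: u) s' = m.
    by rewrite -eqm; apply: eq_bigr => r _; rewrite cs.
  have xtu : count_mem t s' <= count_mem t u by move: xt; rewrite cs /= eqxx.
  pose Inv r := [/\ count_mem r s' <= count_mem r u, ~~ fed (D (r :: u) s') r &
                    forall v, fed (D s s') v -> fed (D (r :: u) s') v].
  have Inv0 : Inv t by rewrite /Inv /D -(f_perm ss su); split.
  have step r r' : neighbour u r r' -> Inv r -> Inv r'.
    case/neighbourP=> e [er er' eq] [_ nfr sub].
    have sub' v : fed (D s s') v -> fed (D (r' :: u) s') v.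
      move/sub; apply: fed_move_tail eq _; by rewrite er.
    have exr := excess_consl r' u s'.
    have le' : count_mem r' s' <= count_mem r' u.
      rewrite leqNgt; apply/negP => lt; move: exr; rewrite leqNgt lt addn0 => exr.
      have ltm : excess (r' :: u) s' < m.
        by rewrite exr -exu excess_consl xtu addn1.
      by have /negP[] := IHm _ ltm (r' :: u) s' (leqnn _) szu ss' t0; apply: sub'.
    split=> //; apply/negP => fr'.
    have exr' : excess (r' :: u) s' = m by rewrite exr -exu excess_consl xtu le'.
    suff ltk : unfed_excess (r' :: u) s' < k.
      by have /negP[] := IHk _ ltk (r' :: u) szu exr' (leqnn _) t0; apply: sub'.
    (* The unit has left the unfed node [t], and at the fed node [r'] it is no longer counted. *)
    apply: leq_trans lek; rewrite /unfed_excess.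
    apply: (@leq_ltn_trans (\sum_(v | ~~ fed (D s s') v) (count_mem v u - count_mem v s'))).
      rewrite big_mkcond [X in _ <= X]big_mkcond; apply: leq_sum => v _.
      case: ifP => // nfv; rewrite ifT; last by apply: contra nfv; apply: sub'.
      by rewrite /=; case: eqP => [r'v|//]; rewrite -r'v fr' in nfv.
    rewrite (bigD1 t) // [X in _ < X](bigD1 t) //= -addSn leq_add //.
      by rewrite cs /= eqxx add1n subSn.
    by apply: leq_sum => v _; rewrite cs /=; lia.
  (* The invariant is carried along to [y0], where it contradicts the deficit. *)
  have [le _ _] : Inv y0 by apply: connect_ind step _ _ (f_conn t y0 szu) Inv0.
  by move: (leq_trans y0lt le); rewrite cs /= ltnNge leq_addl.
(* All nodes in excess are fed: a unit of [s'] is moved from a node [y] in deficit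
   to a node [x] in excess, all of which stay fed. *)
have [y ylt] : exists r, count_mem r s < count_mem r s'.
  by apply: excess_lt; rewrite ?ss // eqm.
have ys' : y \in s' by rewrite -has_pred1 has_count; apply: leq_ltn_trans ylt.
have [u su] : exists u, perm_eq s' (y :: u) by exists (rem y s'); apply: perm_to_rem.
have szu : (size u).+1 = N by rewrite -ss' (perm_size su).
have cs r : count_mem r s' = count_mem r (y :: u) by apply/permP.
have exu : excess s u = m.
  rewrite -eqm -(excess_consr s y u); move: ylt; rewrite cs /= eqxx /= add1n ltnS leqNgt.
  by move=> /negPf ->; rewrite addn0; apply: eq_bigr => r _; rewrite cs.
have [x ltx] : exists r, count_mem r u < count_mem r s.
  by apply: excess_gt; rewrite exu.
(* Excess is measured against [u], so [X] stays the same while the remaining unit of [s']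
   travels. *)
pose X := [set r | count_mem r u < count_mem r s].
pose Inv r := r \notin X /\ forall t, t \in X -> fed (D s (r :: u)) t.
have Inv0 : Inv y.
  split; first by move: ylt; rewrite inE -leqNgt cs /= eqxx.
  move=> t; rewrite inE /D -(f_perm ss' su) => tX; apply: allfed; rewrite cs /=.
  by case: eqP => [yt|//]; move: ylt; rewrite cs yt /= eqxx add1n ltnS leqNgt tX.
have step r r' : neighbour u r r' -> Inv r -> Inv r'.
  case/neighbourP=> e [er er' eq] [rX fedX].
  have fedX' : forall t, t \in X -> fed (D s (r' :: u)) t.
    apply: fed_move_head eq _ _ _ fedX; rewrite ?er ?card_fibre //.
    - by move=> v; rewrite inE -leqNgt !card_fibre //= ltnS => /leq_trans; apply; apply: leq_addl.
    - by move: rX; rewrite inE -leqNgt /= eqxx add1n !ltnS.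
  split=> //; apply/negP => r'X; have := excess_consr s r' u.
  rewrite exu; move: (r'X); rewrite inE => -> exr.
  have ltm : excess s (r' :: u) < m by rewrite -exr addn1.
  by have /negP[] := IHm _ ltm s (r' :: u) (leqnn _) ss szu r'; apply: fedX'.
have [xX _] : Inv x by apply: connect_ind step _ _ (f_conn y x szu) Inv0.
by rewrite inE ltx in xX.
Qed.

End Global.

(** * Linked tope fields and their amalgamations *)

Lemma setD1_sub (T : finType) (A B : {set T}) x :
  x \in A -> x \notin B -> #|A|.-1 <= #|A :&: B| -> A :\ x \subset B.
Proof.
move=> xA xB; have -> : A :&: B = (A :\ x) :&: B.
  by apply/setP => y; rewrite !inE; case: eqP => [->|_] //=; rewrite (negPf xB) andbF.
rewrite (cardsD1 x) xA add1n /= => le; apply/setIidPl/eqP.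
by rewrite eqEcard subsetIl.
Qed.

(** Sets of size [a] that pairwise share [a.-1] points lie in a set of size [a.+1] or share a core
    of size [a.-1]. In the second case take a core point [c], which exists as [1 < a]: the set [A c]
    misses [c], so it must contain all other points of three sets around the core, which are too
    many. *)
Lemma card_common_cover (T : finType) (U : {set T}) (A : T -> {set T}) a :
  1 < a -> (forall x, x \in U -> #|A x| = a) -> (forall x, x \in U -> x \notin A x) ->
  (forall x, x \in U -> A x \subset U) ->
  (forall x y, x \in U -> y \in U -> a.-1 <= #|A x :&: A y|) ->
  #|\bigcup_(x in U) A x| <= a.+1.
Proof.
move=> a1 cA nA sA cAA.
have [->|[x0 x0U]] := set_0Vmem U; first by rewrite big_set0 cards0.
have [p pA0] : exists p, p \in A x0 by apply/card_gt0P; rewrite cA //; lia.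
have pU : p \in U := subsetP (sA _ x0U) _ pA0.
have cUI x y : x \in U -> y \in U -> #|A x :|: A y| + #|A x :&: A y| = a + a.
  by move=> xU yU; rewrite cardsUI !cA.
have neq : A x0 != A p by apply: contraTneq pA0 => ->; apply: nA.
have cI : #|A x0 :&: A p| = a.-1.
  apply/eqP; rewrite eqn_leq cAA // andbT -ltnS prednK; last by lia.
  rewrite -(cA _ x0U) proper_card // properEneq subsetIl andbT.
  apply: contraNneq neq => /setIidPl sub; by rewrite eqEcard sub !cA /=.
have cU : #|A x0 :|: A p| = a.+1 by have := cUI _ _ x0U pU; rewrite cI; lia.
suff sub : \bigcup_(x in U) A x \subset A x0 :|: A p by rewrite -cU subset_leq_card.
apply/bigcupsP => z zU; case: (boolP (A z \subset _)) => // /subsetPn[w wz wU].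
have subI x : x \in U -> w \notin A x -> A z :\ w \subset A x.
  by move=> xU wx; apply: setD1_sub wx _; rewrite // cA // cAA.
have [wx0 wp] : w \notin A x0 /\ w \notin A p by apply/andP; rewrite -negb_or -in_setU.
have eqI : A z :\ w = A x0 :&: A p.
  apply/eqP; rewrite eqEcard subsetI !subI // cI.
  by have := cA z zU; rewrite (cardsD1 w) wz; lia.
have [c cI0] : exists c, c \in A x0 :&: A p by apply/card_gt0P; rewrite cI; lia.
have /setIP[c0 cp] := cI0.
have cU' : c \in U := subsetP (sA _ x0U) _ c0.
have cz : c \in A z by move: cI0; rewrite -eqI => /setD1P[].
have subc x : x \in U -> c \in A x -> A x :\ c \subset A c.
  by move=> xU cx; apply: setD1_sub (nA c cU') _; rewrite // cA // cAA.
have sub : w |: (A x0 :|: A p) :\ c \subset A c.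
  rewrite subUset sub1set setDUl subUset !subc // !andbT.
  apply: (subsetP (subc z zU cz)); rewrite !inE wz andbT.
  by apply: contraNneq wx0 => ->.
have := subset_leq_card sub; rewrite cardsU1 cA // !inE (negPf wx0) (negPf wp) andbF /=.
by move: cU; rewrite (cardsD1 c) inE c0 /= => ->; rewrite ltnn.
Qed.

Section Fields.
Variables L R : finType.
Implicit Types (F : {set L} -> L -> R) (v : R -> nat) (s t : {set L}).

(** A field is a total function, but [F s l] has a meaning only for [l] in [s] and [s] of the right
    size. *)
Definition fib F s r := [set l in s | F s l == r].
Definition supp F t r := \bigcup_(x in t) fib F (t :\ x) r.

Definition tope_field v F := forall s, #|s| = \sum_r v r -> forall r, #|fib F s r| = v r.
(** Linkage is encoded as an upper bound on the supports; equality follows in [card_supp]. *)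
Definition linked v F := [/\ forall r, 0 < v r, tope_field v F &
  forall t, #|t| = (\sum_r v r).+1 -> forall r, #|supp F t r| <= (v r).+1].

(* By [supp_agree] the choice of the removed point is irrelevant. *)
Definition amalg F r t l :=
  if l \in supp F t r then r else F (t :\ odflt l [pick x in supp F t r]) l.

Definition incr v r r' := v r' + (r == r').

Lemma sum_incr v r : \sum_r' incr v r r' = (\sum_r v r).+1.
Proof.
rewrite big_split /= [X in _ + X](bigD1 r) //= [X in _ + (_ + X)]big1 ?eqxx ?addn1 //.
by move=> i /negPf; rewrite eq_sym => ->.
Qed.

Lemma fib_sub F s r : fib F s r \subset s.
Proof. by apply/subsetP => l; rewrite inE => /andP[]. Qed.

Lemma supp_sub F t r : supp F t r \subset t.
Proof. by apply/bigcupsP => x _; apply: subset_trans (fib_sub _ _ _) (subsetDl _ _). Qed.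

Lemma fib_supp F t x r : x \in t -> fib F (t :\ x) r \subset supp F t r.
Proof. by move=> xt; apply: (bigcup_sup x). Qed.

Lemma card_fibs F s (T : {set R}) : \sum_(r in T) #|fib F s r| = #|[set l in s | F s l \in T]|.
Proof.
rewrite -sum1_card (partition_big (F s) (mem T)) /=; last by move=> l; rewrite inE => /andP[].
apply: eq_bigr => r rT; rewrite -sum1_card; apply: eq_bigl => l; rewrite !inE.
by case: eqP => [->|]; rewrite ?andbF // !andbT -[r \in T]/(r \in mem T) rT andbT.
Qed.

Section Linked.
Variables (v : R -> nat) (F : {set L} -> L -> R).
Hypothesis lF : linked v F.
Variable t : {set L}.
Hypothesis ct : #|t| = (\sum_r v r).+1.

Lemma v_gt0 r : 0 < v r. Proof. by case: lF. Qed.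

Lemma card_del x : x \in t -> #|t :\ x| = \sum_r v r.
Proof. by move=> xt; have := cardsD1 x t; rewrite xt ct add1n => -[]. Qed.

Lemma card_fib_del x r : x \in t -> #|fib F (t :\ x) r| = v r.
Proof. by move=> xt; case: lF => _ fF _; apply: fF; apply: card_del. Qed.

Lemma fib_delN x r : x \notin fib F (t :\ x) r.
Proof. by rewrite !inE eqxx. Qed.

Lemma supp_neq0 r : exists x, x \in supp F t r.
Proof.
have [y yt] : exists y, y \in t by apply/card_gt0P; rewrite ct.
have [x xf] : exists x, x \in fib F (t :\ y) r.
  by apply/card_gt0P; rewrite card_fib_del // v_gt0.
by exists x; apply: (subsetP (fib_supp _ _ yt)) xf.
Qed.

Lemma card_supp r : #|supp F t r| = (v r).+1.
Proof.
apply/eqP; rewrite eqn_leq; case: (lF) => _ _ -> //=.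
have [x xs] := supp_neq0 r; have xt := subsetP (supp_sub _ _ _) _ xs.
rewrite (cardsD1 x) xs add1n ltnS -(card_fib_del r xt) subset_leq_card //.
by rewrite subsetD1 fib_supp // fib_delN.
Qed.

(** The fibre on [t :\ x] avoids [x], and by [card_supp] it is as large as the rest of the
    support. *)
Lemma fib_suppD x r : x \in supp F t r -> fib F (t :\ x) r = supp F t r :\ x.
Proof.
move=> xs; have xt := subsetP (supp_sub _ _ _) _ xs.
apply/eqP; rewrite eqEcard subsetD1 fib_supp // fib_delN /= card_fib_del //.
by have := card_supp r; rewrite (cardsD1 x) xs add1n => -[->].
Qed.

Lemma mem_supp z r l : z \in supp F t r -> l \in t -> l != z ->
  (l \in supp F t r) = (F (t :\ z) l == r).
Proof. by move=> zs lt lz; have /setP/(_ l) := fib_suppD zs; rewrite !inE lz lt. Qed.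

(* If the fibres over a set [T] of nodes differ, each [supp F t r] with [r] in [T]
   lies in the set [W] filled by these fibres, and removing a point of [W] leaves
   too little room for them. *)
Lemma supp_agree r x y : x \in supp F t r -> y \in supp F t r ->
  forall l, l \in t -> l \notin supp F t r -> F (t :\ x) l = F (t :\ y) l.
Proof.
move=> xs ys; have xt := subsetP (supp_sub _ _ _) _ xs.
have yt := subsetP (supp_sub _ _ _) _ ys.
pose T := [set q | (q != r) && (fib F (t :\ x) q != fib F (t :\ y) q)].
have neq_r z l : z \in supp F t r -> l \in t -> l \notin supp F t r -> F (t :\ z) l != r.
  move=> zs lt ls; rewrite -mem_supp //; by apply: contraNneq ls => ->.
have in_fib z l : z \in supp F t r -> l \in t -> l \notin supp F t r ->
    l \in fib F (t :\ z) (F (t :\ z) l).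
  move=> zs lt ls; rewrite !inE eqxx lt !andbT; by apply: contraNneq ls => ->.
have [T0|[q qT]] := set_0Vmem T.
  move=> l lt ls; have := in_fib x l xs lt ls; set q := F _ l.
  have : q \notin T by rewrite T0 inE.
  by rewrite inE neq_r //= negbK => /eqP ->; rewrite inE => /andP[_ /eqP].
pose W z := [set l in t :\ z | F (t :\ z) l \in T].
have inW z l : (l \in W z) = [&& l != z, l \in t & F (t :\ z) l \in T].
  by rewrite in_set in_setD1 andbA.
(* A point of [W z] lies outside [supp F t r]. If its value on [t :\ z'] were outside [T], the
   fibres over that value would coincide, and its value on [t :\ z] would be the same. *)
have WE z z' : z \in supp F t r -> z' \in supp F t r ->
    (forall q, (q \in T) = (q != r) && (fib F (t :\ z) q != fib F (t :\ z') q)) ->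
    W z \subset W z'.
  move=> zs zs' TE; apply/subsetP => l; rewrite !inW => /and3P[lz lt lT].
  have ls : l \notin supp F t r.
    by apply: contraL lT => ls; rewrite TE -(mem_supp zs) // ls.
  have lz' : l != z' by apply: contraNneq ls => ->.
  rewrite lz' lt /=; apply: contraLR lT; rewrite !TE neq_r //= negbK => /eqP eq.
  have : l \in fib F (t :\ z') (F (t :\ z') l) by apply: in_fib.
  by rewrite -eq inE => /andP[_ /eqP ->]; rewrite eq eqxx andbF.
have WW : W x = W y.
  by apply/eqP; rewrite eqEsubset !WE // => z; rewrite inE // eq_sym [_ == fib _ _ _]eq_sym.
have cW : #|W x| = \sum_(q in T) v q.
  by rewrite -card_fibs; apply: eq_bigr => z _; apply: card_fib_del.
have sub z : z \in T -> supp F t z \subset W x.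
  move=> zT; have /andP[nz dif] : (z != r) && (fib F (t :\ x) z != fib F (t :\ y) z).
    by move: zT; rewrite inE.
  have fW z' : fib F (t :\ z') z \subset W z'.
    by apply/subsetP => l; rewrite inE [l \in W _]inE => /andP[-> /eqP ->].
  (* Two different fibres of size [v z] already fill the [(v z).+1] points of the support. *)
  have <- : fib F (t :\ x) z :|: fib F (t :\ y) z = supp F t z.
    apply/eqP; rewrite eqEcard subUset !fib_supp //= card_supp.
    rewrite -(card_fib_del z xt) proper_card // properEneq subsetUl andbT.
    apply: contraNneq dif => eq; rewrite eq_sym eqEcard !card_fib_del // leqnn andbT.
    by rewrite eq subsetUr.
  by rewrite subUset fW WW fW.
have [l lW] : exists l, l \in W x.
  have [l ls] := supp_neq0 q; by exists l; apply: (subsetP (sub q qT)).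
have lt : l \in t by move: lW; rewrite inW => /and3P[].
have : #|[set k in t :\ l | F (t :\ l) k \in T]| <= #|W x :\ l|.
  apply/subset_leq_card/subsetP => k; rewrite inE => /andP[kt kT].
  rewrite in_setD1 (subsetP (sub _ kT)) ?andbT; first by move: kt; rewrite !inE => /andP[].
  by apply: (subsetP (fib_supp _ _ lt)); rewrite inE kt eqxx.
rewrite -card_fibs (eq_bigr v) => [|z _]; last exact: card_fib_del.
by rewrite -cW (cardsD1 l (W x)) lW ltnn.
Qed.

Lemma amalg_del r x l : x \in supp F t r -> l \in t ->
  amalg F r t l = if l == x then r else F (t :\ x) l.
Proof.
move=> xs lt; rewrite /amalg; case: ifPn => ls.
  by case: eqP => // /eqP lx; apply/esym/eqP; rewrite -mem_supp.
case: eqP => [lx|_]; first by rewrite lx xs in ls.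
by case: pickP => [y ys|/(_ x)]; [apply: (@supp_agree r) | rewrite /= xs].
Qed.

End Linked.
End Fields.

Section Amalgamation.
Variables L R : finType.
Implicit Types (F : {set L} -> L -> R) (v : R -> nat) (s t : {set L}).

Lemma setD1C (t : {set L}) x y : t :\ x :\ y = t :\ y :\ x.
Proof. by rewrite !setDDl setUC. Qed.

Section Step.
Variables (v : R -> nat) (F : {set L} -> L -> R) (r : R).
Hypothesis lF : linked v F.

Lemma fib_amalg_eq t : #|t| = (\sum_r v r).+1 -> fib (amalg F r) t r = supp F t r.
Proof.
move=> ct; have [x xs] := supp_neq0 lF ct r.
apply/setP => l; rewrite inE; case: (boolP (l \in t)) => [lt|lt] /=; last first.
  by apply/esym; apply: contraNF lt => /(subsetP (supp_sub _ _ _)).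
rewrite (amalg_del lF ct xs lt); case: (eqVneq l x) => [->|lx]; first by rewrite xs eqxx.
by have := fib_suppD lF ct xs => /setP/(_ l); rewrite !inE lx lt.
Qed.

Lemma fib_amalg_neq t q x : #|t| = (\sum_r v r).+1 -> q != r -> x \in supp F t r ->
  fib (amalg F r) t q = fib F (t :\ x) q.
Proof.
move=> ct /negPf qr xs; apply/setP => l; rewrite !inE.
case: (boolP (l \in t)) => [lt|lt] /=; last by rewrite andbF.
by rewrite (amalg_del lF ct xs lt); case: (eqVneq l x) => //= _; rewrite eq_sym.
Qed.

Lemma tope_field_amalg : tope_field (incr v r) (amalg F r).
Proof.
move=> t; rewrite sum_incr => ct q; rewrite /incr.
case: (eqVneq r q) => [<-|rq]; first by rewrite fib_amalg_eq // (card_supp lF ct) addn1.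
have [x xs] := supp_neq0 lF ct r; rewrite (fib_amalg_neq ct _ xs); last by rewrite eq_sym.
by rewrite (card_fib_del lF ct) ?addn0 //; apply: (subsetP (supp_sub _ _ _)) xs.
Qed.

Section TwoMore.
Variable U : {set L}.
Hypothesis cU : #|U| = (\sum_r v r).+2.

Lemma card_del2 x : x \in U -> #|U :\ x| = (\sum_r v r).+1.
Proof. by move=> xU; have := cardsD1 x U; rewrite xU cU add1n => -[]. Qed.

Lemma supp_memU x y q : y \in supp F (U :\ x) q -> y != x /\ y \in U.
Proof. by move/(subsetP (supp_sub _ _ _)); rewrite !inE => /andP[]. Qed.

(** The supports on [U :\ x] and [U :\ y] share the fibre on [U] without both points, so
    [card_common_cover] applies with [a] equal to [(v q).+1]. *)
Lemma card_bigcup_supp q : #|\bigcup_(x in U) supp F (U :\ x) q| <= (v q).+2.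
Proof.
apply: card_common_cover => [|x xU|x xU|x xU|x y xU yU].
- by rewrite ltnS (v_gt0 lF).
- exact: card_supp (card_del2 xU) _.
- by apply: contraT; rewrite negbK => /supp_memU[]; rewrite eqxx.
- by apply: subset_trans (supp_sub _ _ _) (subsetDl _ _).
case: (eqVneq x y) => [->|xy]; first by rewrite setIid (card_supp lF (card_del2 yU)).
have yx : y \in U :\ x by rewrite !inE eq_sym xy.
rewrite -(card_fib_del lF (card_del2 xU) q yx) subset_leq_card // subsetI fib_supp //.
by rewrite setD1C fib_supp // !inE xy.
Qed.

Lemma supp_meet x y q : x \in U -> y \in U ->
  exists z, (z \in supp F (U :\ x) q) && (z \in supp F (U :\ y) q).
Proof.
move=> xU yU; case: (eqVneq x y) => [->|xy].
  by have [z zs] := supp_neq0 lF (card_del2 yU) q; exists z; rewrite zs.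
have yx : y \in U :\ x by rewrite !inE eq_sym xy.
have [z zf] : exists z, z \in fib F (U :\ x :\ y) q.
  by apply/card_gt0P; rewrite (card_fib_del lF (card_del2 xU)) // (v_gt0 lF).
exists z; rewrite (subsetP (fib_supp F q yx)) //=.
by rewrite setD1C in zf; apply: subsetP zf; rewrite fib_supp // !inE xy.
Qed.

(** The fibre [B y] is the same for all [y] in [K], and [b] is one of its points; [B b] misses [b],
    so it is a different fibre. For [y] in [A b] both lie in [supp F (U :\ y) q] and fill it. Every
    [B x] lies in such a support, because [A x] meets [A b]. The last clause serves [amalgC]. *)
Lemma supp_amalg_neq q : q != r ->
  exists b, [/\ b \in supp (amalg F r) U q, #|supp (amalg F r) U q| <= (v q).+1 &
    forall y, y \in supp F (U :\ b) r -> supp F (U :\ y) q = supp (amalg F r) U q].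
Proof.
move=> qr; pose A x := supp F (U :\ x) r; pose B x := fib (amalg F r) (U :\ x) q.
pose K := \bigcup_(x in U) A x.
have AK y : y \in K -> A y = K :\ y.
  move=> yK; have /bigcupP[z zU yz] := yK; have [_ yU] := supp_memU yz.
  apply/eqP; rewrite eqEcard subsetD1 bigcup_sup //=.
  rewrite (card_supp lF (card_del2 yU)) -ltnS -[_.+2]/(_.+2).
  have := card_bigcup_supp r; rewrite -/K (cardsD1 y K) yK add1n ltnS => ->.
  by rewrite andbT; apply: contraT; rewrite negbK => /supp_memU[]; rewrite eqxx.
have KU y : y \in K -> y \in U by case/bigcupP=> z _ /supp_memU[].
have BE x y : x \in U -> y \in A x -> B x = fib F (U :\ x :\ y) q.
  by move=> xU yA; apply: fib_amalg_neq => //; apply: card_del2.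
have Bsub x y : x \in U -> y \in A x -> B x \subset supp F (U :\ y) q.
  move=> xU yA; rewrite (BE x y) // setD1C; apply: fib_supp.
  by have [yx _] := supp_memU yA; rewrite !inE eq_sym yx.
(* Both are the fibre of [F] over [q] on [U] without [y] and [y']. *)
have Bconst y y' : y \in K -> y' \in K -> B y = B y'.
  move=> yK y'K; case: (eqVneq y y') => [->//|yy'].
  rewrite (BE y y') ?KU ?(BE y' y) ?KU ?AK ?inE 1?setD1C ?yy' ?yK //.
  by rewrite eq_sym yy'.
have cA x : x \in U -> #|A x| = (v r).+1 by move=> xU; apply: card_supp (card_del2 xU) _.
have cB x : x \in U -> #|B x| = v q.
  move=> xU; have -> : #|B x| = incr v r q.
    by apply: tope_field_amalg; rewrite sum_incr card_del2.
  by rewrite /incr eq_sym (negPf qr) addn0.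
have [x0 x0U] : exists x, x \in U by apply/card_gt0P; rewrite cU.
have [y0 y0A] : exists y, y \in A x0 by apply/card_gt0P; rewrite cA.
have y0K : y0 \in K by apply/bigcupP; exists x0.
have BsubK y : y \in K -> B y0 \subset supp F (U :\ y) q.
  move=> yK; have [z zA] : exists z, z \in A y by apply/card_gt0P; rewrite cA // KU.
  have zK : z \in K by apply/bigcupP; exists y => //; apply: KU.
  rewrite (Bconst y0 z) //; apply: Bsub (KU _ zK) _.
  by rewrite AK // !inE yK andbT; have [] := supp_memU zA; rewrite eq_sym.
have [b bB] : exists b, b \in B y0.
  by apply/card_gt0P; rewrite cB ?KU // (v_gt0 lF).
have bU : b \in U by move: bB; rewrite !inE => /andP[/andP[]].
pose W := B y0 :|: B b.
have nbB : b \notin B b by rewrite !inE eqxx.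
have cW : v q < #|W|.
  rewrite -(cB b bU) proper_card // properEneq subsetUr andbT.
  by apply: contraNneq nbB => ->; rewrite inE bB.
have eW y : y \in A b -> supp F (U :\ y) q = W.
  move=> yA; have [_ yU] := supp_memU yA.
  apply/esym/eqP; rewrite eqEcard (card_supp lF (card_del2 yU)) cW andbT.
  by rewrite subUset BsubK ?Bsub //; apply/bigcupP; exists b.
have SW : supp (amalg F r) U q = W.
  apply/eqP; rewrite eqEsubset; apply/andP; split.
    apply/bigcupsP => x xU; have [y /andP[yx yb]] := supp_meet r xU bU.
    by rewrite -(eW y) //; apply: Bsub.
  by rewrite subUset; apply/andP; split; apply: fib_supp => //; apply: KU.
exists b; rewrite SW; split=> //; first by rewrite inE bB.
have [y yA] : exists y, y \in A b by apply/card_gt0P; rewrite cA.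
have [_ yU] := supp_memU yA.
by rewrite -(eW y yA) (card_supp lF (card_del2 yU)).
Qed.

End TwoMore.

Lemma linked_amalg : linked (incr v r) (amalg F r).
Proof.
split=> [q||U]; first by rewrite /incr addn_gt0 (v_gt0 lF).
  exact: tope_field_amalg.
rewrite sum_incr => cU q; rewrite /incr; case: (eqVneq r q) => [<-|rq].
  rewrite addn1 /supp (eq_bigr (fun x => supp F (U :\ x) r)).
    exact: (card_bigcup_supp cU r).
  by move=> x xU; rewrite fib_amalg_eq // card_del2.
by rewrite addn0; have [|b []] := @supp_amalg_neq U cU q; first by rewrite eq_sym.
Qed.

End Step.

(** With [b] from [supp_amalg_neq] and [y] in [supp F (U :\ b) r], both sides send [y] to [r] and
    equal [amalg F q (U :\ y)] elsewhere. *)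
Lemma amalgC v F r q (U : {set L}) : linked v F -> #|U| = (\sum_r v r).+2 ->
  {in U, amalg (amalg F r) q U =1 amalg (amalg F q) r U}.
Proof.
move=> lF cU; case: (eqVneq q r) => [->//|qr].
have [b [bs _ eW]] := supp_amalg_neq lF cU qr.
have bU := subsetP (supp_sub _ _ _) _ bs.
have cUi r' : #|U| = (\sum_r'' incr v r' r'').+1 by rewrite sum_incr.
have PE y l : y \in supp F (U :\ b) r -> l \in U -> 
    amalg (amalg F r) q U l = if l == y then r else amalg F q (U :\ y) l.
  move=> ys lU; have [yb yU] := supp_memU ys.
  have bq : b \in supp F (U :\ y) q by rewrite eW.
  have del k := @amalg_del _ _ _ _ lF _ (card_del2 cU yU) q b k bq.
  rewrite (amalg_del (linked_amalg r lF) (cUi r) bs lU).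
  case: (eqVneq l b) => [->|lb].
    by rewrite eq_sym (negPf yb) del ?eqxx // !inE eq_sym yb.
  rewrite (amalg_del lF (card_del2 cU bU) ys) ?inE ?lb //.
  case: (eqVneq l y) => // ly.
  by rewrite del ?inE ?ly // (negPf lb) setD1C.
(* Comparing the formula for [y] with the one for [y'] shows that [y] lies in
   [supp (amalg F q) U r]. *)
have [y [y' [ys ys' yy']]] : exists y y', [/\ y \in supp F (U :\ b) r,
    y' \in supp F (U :\ b) r & y != y'].
  have /card_gt1P[y [y' [? ? ?]]] : 1 < #|supp F (U :\ b) r|.
    by rewrite (card_supp lF (card_del2 cU bU)) ltnS (v_gt0 lF).
  by exists y, y'.
have [yb yU] := supp_memU ys; have [y'b y'U] := supp_memU ys'.
have yS : y \in supp (amalg F q) U r.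
  apply: (subsetP (fib_supp _ _ y'U)); rewrite !inE yy' yU /=.
  by have := PE y' y ys' yU; rewrite (negPf yy') => <-; rewrite (PE y) // eqxx.
by move=> l lU; rewrite (PE y) // (amalg_del (linked_amalg q lF) (cUi q) yS lU).
Qed.

Lemma amalg_eq v F F' r t : linked v F -> linked v F' -> #|t| = (\sum_r v r).+1 ->
  (forall s, #|s| = \sum_r v r -> {in s, F s =1 F' s}) ->
  {in t, amalg F r t =1 amalg F' r t}.
Proof.
move=> lF lF' ct FF' l lt.
have eqs : supp F t r = supp F' t r.
  apply: eq_bigr => x xt; apply/setP => k; rewrite [LHS]inE [RHS]inE.
  by case: (boolP (k \in _)) => //= kt; rewrite FF' // (card_del ct).
have [x xs] := supp_neq0 lF ct r; have xs' := xs; rewrite eqs in xs'.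
rewrite (amalg_del lF ct xs lt) (amalg_del lF' ct xs' lt).
case: (eqVneq l x) => // lx; rewrite FF' ?inE ?lx //.
by apply: card_del ct _ _; apply: (subsetP (supp_sub _ _ _)) xs.
Qed.

End Amalgamation.

(** * Iterated amalgamations: connectivity, independence of the order, extension to all of [L] *)

Section Extension.
Variables L R : finType.
Implicit Types (F : {set L} -> L -> R) (v : R -> nat) (t : {set L}) (s u : seq R).

Definition meets F t : rel R := fun r r' => supp F t r :&: supp F t r' != set0.

(** The supports over a set [A] of nodes cover more points than the fibres over [A] need, since
    removing one covered point leaves room for all these fibres. A component and its complement
    would thus cover disjoint parts of [t] with too many points in total. *)
Lemma supp_connect v F t r r' : linked v F -> #|t| = (\sum_r v r).+1 ->
  connect (meets F t) r r'.
Proof.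
move=> lF ct; apply/negPn/negP => nc.
pose T := [set q | connect (meets F t) r q].
pose W (A : {set R}) := \bigcup_(q in A) supp F t q.
have lt (A : {set R}) q : q \in A -> \sum_(q in A) v q < #|W A|.
  move=> qA; have [x xs] := supp_neq0 lF ct q; have xt := subsetP (supp_sub _ _ _) _ xs.
  rewrite (cardsD1 x) (subsetP (bigcup_sup q qA) _ xs) add1n ltnS.
  rewrite -(eq_bigr _ (fun z _ => card_fib_del lF ct z xt)) card_fibs.
  apply/subset_leq_card/subsetP => l; rewrite inE => /andP[lt lA].
  rewrite in_setD1 (subsetP (bigcup_sup _ lA)) ?andbT; first by case/setD1P: lt.
  by apply: (subsetP (fib_supp _ _ xt)); rewrite inE lt eqxx.
have rT : r \in T by rewrite inE connect0.
have r'T : r' \in ~: T by rewrite !inE.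
have dis : [disjoint W T & W (~: T)].
  apply/pred0P => x /=; apply/negP => /andP[/bigcupP[a aT xa] /bigcupP[b bT xb]].
  move: aT bT; rewrite !inE => ra /negP[]; apply: connect_trans ra (connect1 _).
  by apply/set0Pn; exists x; rewrite inE xa.
have WT : #|W T| + #|W (~: T)| <= #|t|.
  have -> : #|W T| + #|W (~: T)| = #|W T :|: W (~: T)|.
    by rewrite cardsU disjoint_setI0 // cards0 subn0.
  by apply/subset_leq_card; rewrite subUset; apply/andP; split; apply/bigcupsP => q _; apply: supp_sub.
have := leq_trans (leq_add (lt T r rT) (lt _ r' r'T)) WT; rewrite ct.
suff -> : \sum_r v r = \sum_(q in T) v q + \sum_(q in ~: T) v q.
  by rewrite addSn addnS ltnS ltnn.
rewrite (bigID (mem T)) /=; congr (_ + _).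
by apply: eq_bigl => q; rewrite in_setC.
Qed.

Lemma mem_some_supp F t l : l \in t -> 1 < #|t| -> exists r, l \in supp F t r.
Proof.
move=> lt /card_gt1P[x [y [xt yt xy]]].
have [z zt zl] : exists2 z, z \in t & z != l.
  by case: (eqVneq x l) => [xl|]; [exists y => //; rewrite -xl eq_sym | exists x].
exists (F (t :\ z) l); apply: (subsetP (fib_supp _ _ zt)).
by rewrite !inE eq_sym zl lt eqxx.
Qed.

Definition amalgs F s := foldr (fun r G => amalg G r) F s.
Definition incrs v s := foldr (fun r w => incr w r) v s.

Lemma incrsE v s r : incrs v s r = v r + count_mem r s.
Proof. by elim: s => [|x s IHs] /=; rewrite ?addn0 // /incr IHs addnAC addnA. Qed.

Lemma sum_incrs v s : \sum_r incrs v s r = \sum_r v r + size s.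
Proof. by elim: s => [|x s IHs] /=; rewrite ?addn0 // sum_incr IHs addnS. Qed.

Lemma linked_amalgs v F s : linked v F -> linked (incrs v s) (amalgs F s).
Proof. by move=> lF; elim: s => //= r s IHs; apply: linked_amalg. Qed.

Lemma linked_eq v v' F : v =1 v' -> linked v F -> linked v' F.
Proof.
move=> vv' [v0 fF lF]; have sv : \sum_r v' r = \sum_r v r by apply: eq_bigr => r _; rewrite vv'.
split=> [r|t|t]; rewrite -?vv' // sv => ct r; rewrite -vv'; [exact: fF | exact: lF].
Qed.

Section Permutation.
Variables (v : R -> nat) (F : {set L} -> L -> R).
Hypothesis lF : linked v F.

Lemma amalgs_cons r s s' : perm_eq s s' ->
  (forall t, #|t| = \sum_r v r + size s -> {in t, amalgs F s t =1 amalgs F s' t}) ->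
  forall t, #|t| = \sum_r v r + size (r :: s) ->
    {in t, amalgs F (r :: s) t =1 amalgs F (r :: s') t}.
Proof.
move=> /permP ss' eqs t ct; apply: (@amalg_eq _ _ (incrs v s)).
- exact: linked_amalgs.
- by apply: linked_eq (linked_amalgs s' lF) => q; rewrite !incrsE ss'.
- by rewrite sum_incrs ct /= addnS.
- by move=> t'; rewrite sum_incrs; apply: eqs.
Qed.

Lemma amalgs_move r s1 s2 t : #|t| = \sum_r v r + (size s1 + size s2).+1 ->
  {in t, amalgs F (r :: s1 ++ s2) t =1 amalgs F (s1 ++ r :: s2) t}.
Proof.
elim: s1 t => [//|x s1 IHs] t ct l lt.
have /= <- := @amalgs_cons x (r :: s1 ++ s2) (s1 ++ r :: s2) _ _ t _ l lt.
- apply: amalgC (linked_amalgs (s1 ++ s2) lF) _ l lt.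
  by rewrite sum_incrs ct size_cat /= addSn !addnS.
- by rewrite perm_sym; apply: permEl (perm_catCA s1 [:: r] s2).
- by move=> t' ct'; apply: IHs; rewrite ct' /= size_cat.
- by rewrite ct /= size_cat addSn.
Qed.

Lemma amalgs_perm s s' : perm_eq s s' ->
  forall t, #|t| = \sum_r v r + size s -> {in t, amalgs F s t =1 amalgs F s' t}.
Proof.
elim: s s' => [|r s IHs] s' ss'; first by have := perm_size ss'; case: s' ss'.
have : r \in s' by rewrite -(perm_mem ss') mem_head.
move=> rs'; case/splitPr: rs' ss' => s1 s2 ss'.
have ss12 : perm_eq s (s1 ++ s2).
  rewrite -(perm_cons r) (perm_trans ss') //.
  exact: permEl (perm_catCA s1 [:: r] s2).
move=> t ct l lt; rewrite (amalgs_cons (r := r) ss12 (IHs _ ss12)) // amalgs_move //.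
by rewrite ct /= (perm_size ss12) size_cat.
Qed.

(** Points are added one at a time: a new point [l] lies in some support, and amalgamating over that
    node sends [l] there and changes nothing on [t]. A nonempty [t] ensures that [l] is in a fibre
    after the removal of another point. *)
Lemma amalgs_extend s t : t != set0 -> #|t| = \sum_r v r + size s ->
  exists2 s', #|L| = \sum_r v r + size s' & {in t, amalgs F s t =1 amalgs F s' setT}.
Proof.
move: {2}#|~: t| (leqnn #|~: t|) => k; elim: k s t => [|k IHk] s t lek t0 ct.
  have tT : t = setT.
    by apply/eqP; rewrite -subTset -[t]setCK -setC0 setCS subset0 -cards_eq0 -leqn0.
  by rewrite tT in ct *; exists s; rewrite // -cardsT.
have [|[l]] := set_0Vmem (~: t).
  by rewrite -setCT => /setC_inj tT; rewrite tT in ct *; exists s; rewrite // -cardsT.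
rewrite inE => lt; pose t' := l |: t.
have ct' : #|t'| = (\sum_r incrs v s r).+1 by rewrite cardsU1 lt add1n ct sum_incrs.
have lt' : l \in t' by rewrite !inE eqxx.
have [r ls] : exists r, l \in supp (amalgs F s) t' r.
  by apply: mem_some_supp; rewrite // cardsU1 lt ltnS card_gt0.
have [|||s' cs' eqs] := IHk (r :: s) t'; rewrite /= ?addnS.
- rewrite setCU setIC -setDE; have := lek.
  by rewrite (cardsD1 l (~: t)) inE lt.
- by apply/set0Pn; exists l.
- by rewrite ct' sum_incrs.
exists s' => // k' k't; have k't' : k' \in t' by rewrite !inE k't orbT.
rewrite -eqs //= (amalg_del (linked_amalgs s lF) ct' ls k't').
have /negPf -> : k' != l by apply: contraNneq lt => <-.
by rewrite setU1K.
Qed.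

End Permutation.

Lemma amalgs_no_cycle F s s' : linked (fun=> 1) F ->
  #|L| = #|R| + size s -> #|L| = #|R| + size s' ->
  forall r, ~~ fed (arcs predT (amalgs F s setT) (amalgs F s' setT)) r.
Proof.
move=> lF cs cs' r; have sum1 : \sum_(r : R) 1 = #|R| by rewrite sum1_card.
have cT s0 : size s0 = size s -> #|[set: L]| = \sum_(r : R) 1 + size s0.
  by move=> ->; rewrite sum1 cardsT.
(* Finite functions allow permutation invariance to be an equality of functions. *)
pose f s0 := [ffun l => amalgs F s0 setT l].
have := @no_cycle L R (size s) f _ _ _ s s' erefl _ r.
have sub : subrel (connect (arcs predT (amalgs F s setT) (amalgs F s' setT)))
                  (connect (arcs predT (f s) (f s'))).
  by apply: arcs_eq => l _; rewrite ffunE.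
move=> no; apply/negP => /(fed_mono sub); apply/negP; apply: no.
- move=> s0 q ss0; have [_ fF _] := linked_amalgs s0 lF.
  have := fF setT _ q; rewrite sum_incrs incrsE add1n => <-; last exact: cT.
  by apply: eq_card => l; rewrite !inE ffunE.
- move=> s1 s2 ss1 ss12; apply/ffunP => l; rewrite !ffunE.
  by apply: (amalgs_perm lF ss12); rewrite ?inE // (cT s1 ss1).
- move=> u q q' su; have cu : #|[set: L]| = (\sum_r incrs (fun=> 1) u r).+1.
    by rewrite sum_incrs cardsT cs -su sum1 addnS.
  have := supp_connect q q' (linked_amalgs u lF) cu; apply: connect_sub.
  (* A point [e] in both supports realises the single move: off [e] both amalgamations equal
     [amalgs F u] on the complement of [e]. *)
  move=> a b /set0Pn[e /setIP[ea eb]]; apply/connect1/existsP; exists e.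
  have del c l := @amalg_del _ _ _ _ (linked_amalgs u lF) _ cu c e l.
  rewrite !ffunE /= !del // !eqxx /=; apply/forallP => l; apply/implyP => /negPf le.
  by rewrite !ffunE /= !del // le.
- by apply/eqP; rewrite -(eqn_add2l #|R|) -cs -cs'.
Qed.

End Extension.

(** * Linkage matching fields *)

Section Exchange.
Variables L R : finType.
Variable F : {set L} -> L -> R.
Hypothesis tF : tope_field (fun=> 1) F.

Section Tree.
Variables (t : {set L}) (j j' : R -> L).
Hypotheses (ct : #|t| = #|R|.+1) (jt : forall r, j r \in t) (j't : forall r, j' r \in t).
Hypothesis jj' : forall r, j r != j' r.
Hypothesis agree : forall r q, q != r -> fib F (t :\ j r) q = fib F (t :\ j' r) q.

(** This is the linkage graph on [t], with one edge for each node of [R]; it turns out to be a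
    tree. *)
Definition tree_edge : rel L := fun x y =>
  [exists r, [|| (x == j r) && (y == j' r) | (x == j' r) && (y == j r)]].

Lemma tree_edge_sym : symmetric tree_edge.
Proof. by move=> x y; apply: eq_existsb => r; rewrite orbC ![(_ == j _) && _]andbC. Qed.

Lemma card_fib_tree x r : x \in t -> #|fib F (t :\ x) r| = 1.
Proof.
move=> xt; apply: tF; rewrite sum1_card.
by have := cardsD1 x t; rewrite xt ct add1n => -[].
Qed.

(** Every node other than [r] has the same partner for both removals, which leaves only the other
    end of the edge for [r]. *)
Lemma fib_end r : fib F (t :\ j r) r = [set j' r] /\ fib F (t :\ j' r) r = [set j r].
Proof.
have key x y : x \in t -> y \in t -> x != y ->
    (forall q, q != r -> fib F (t :\ x) q = fib F (t :\ y) q) -> fib F (t :\ x) r = [set y].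
  move=> xt yt xy eq; apply/esym/eqP; rewrite eqEcard cards1 card_fib_tree // leqnn andbT.
  rewrite sub1set; case: (eqVneq (F (t :\ x) y) r) => [<-|/eq eqr].
    by rewrite !inE eq_sym xy yt eqxx.
  have : y \in fib F (t :\ x) (F (t :\ x) y) by rewrite !inE eq_sym xy yt eqxx.
  by rewrite eqr !inE eqxx.
by split; apply: key; rewrite // 1?eq_sym // => q /agree.
Qed.

(* Along an edge [j q, j' q] only the partner of [q] changes. *)
Lemma fib_tree r x : connect tree_edge (j r) x ->
  fib F (t :\ x) r \subset [set j r; j' r].
Proof.
move=> c; apply: (connect_ind (P := fun x => fib F (t :\ x) r \subset [set j r; j' r]) _ c).
  have [e1 e2] := fib_end r => a b /existsP[q /orP[]/andP[/eqP -> /eqP ->]];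
    case: (eqVneq q r) => [->|qr]; rewrite ?e1 ?e2 ?sub1set ?inE ?eqxx ?orbT //.
  - by rewrite agree // eq_sym.
  - by rewrite -agree // eq_sym.
by have [-> _] := fib_end r; rewrite sub1set !inE eqxx orbT.
Qed.

Definition tree_closed (C : {set L}) := C \subset t /\ forall r, (j r \in C) = (j' r \in C).

Lemma connect_tree_sym : connect_sym tree_edge.
Proof. exact: sym_connect_sym tree_edge_sym. Qed.

Lemma tree_edgeP r : connect tree_edge (j r) (j' r).
Proof. by apply/connect1/existsP; exists r; rewrite !eqxx. Qed.

Lemma tree_closed_part C x : tree_closed C ->
  tree_closed [set z in C | connect tree_edge x z] /\
  tree_closed (C :\: [set z in C | connect tree_edge x z]).
Proof.
move=> [Ct jC]; have key r : connect tree_edge x (j r) = connect tree_edge x (j' r).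
  by apply: same_connect_r connect_tree_sym _ _ _ _; apply: tree_edgeP.
split; split=> [|r]; rewrite ?inE ?jC ?key //.
  by apply: subset_trans Ct; apply/subsetP => z; rewrite inE => /andP[].
by apply: subset_trans Ct; apply: subsetDl.
Qed.

(** A closed set spans fewer edges than it has points: split off the component [A] of a point [x]
    and use induction on the rest. *)
Lemma tree_count C : tree_closed C -> C != set0 -> #|[set r | j r \in C]| < #|C|.
Proof.
move: {2}#|C| (leqnn #|C|) => k; elim: k C => [|k IHk] C leC cC C0.
  by move: C0; rewrite -cards_eq0 -leqn0 leC.
have [x xC] := set0Pn _ C0; have [Ct jC] := cC.
have xt := subsetP Ct _ xC.
set A := [set z in C | connect tree_edge x z].
have [cA cCA] : tree_closed A /\ tree_closed (C :\: A) by apply: tree_closed_part.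
have AC : A \subset C by apply/subsetP => z; rewrite inE => /andP[].
have xA : x \in A by rewrite inE xC connect0.
have ltA : #|[set r | j r \in A]| < #|A|.
  (* The matching on [t :\ x] assigns to each edge in [A] one of its ends by [fib_tree], so these
     edges inject into [A :\ x]. *)
  rewrite (cardsD1 x A) xA add1n ltnS -sum1_card.
  rewrite (eq_bigr (fun r => #|fib F (t :\ x) r|)) => [|r _]; last by rewrite card_fib_tree.
  rewrite card_fibs; apply/subset_leq_card/subsetP => l; rewrite in_set => /andP[lt].
  rewrite in_set => rA; rewrite in_setD1; have /setD1P[-> _] := lt => /=.
  set q := F (t :\ x) l in rA *; have /setIdP[_ xq] := rA.
  have sub : fib F (t :\ x) q \subset [set j q; j' q].
    by apply: fib_tree; rewrite // connect_tree_sym.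
  have /(subsetP sub) : l \in fib F (t :\ x) q by rewrite inE lt eqxx.
  by case/set2P => ->; rewrite -?cA.2.
have [CA0|CA0] := eqVneq (C :\: A) set0.
  have -> : C = A by apply/eqP; rewrite eqEsubset AC -setD_eq0 CA0 eqxx.
  exact: ltA.
have ltCA : #|[set r | j r \in C :\: A]| < #|C :\: A|.
  apply: IHk cCA CA0; rewrite -ltnS; apply: leq_trans leC.
  by rewrite -(cardsID A C) (setIidPr AC) -[X in X <= _]add1n leq_add2r; apply/card_gt0P; exists x.
rewrite -(cardsID A C) (setIidPr AC).
rewrite -(cardsID [set r | j r \in A] [set r | j r \in C]).
have -> : [set r | j r \in C] :&: [set r | j r \in A] = [set r | j r \in A].
  by apply/setIidPr/subsetP => r; rewrite !inE => /andP[].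
have -> : [set r | j r \in C] :\: [set r | j r \in A] = [set r | j r \in C :\: A].
  by apply/setP => r; rewrite !inE.
by rewrite -addSn leq_add // ltnW.
Qed.

(** Otherwise [tree_count] for a component and its complement leaves at most [#|t| - 2] edges, but
    there are [#|R|], which is [#|t| - 1]. *)
Lemma tree_connected x y : x \in t -> y \in t -> connect tree_edge x y.
Proof.
move=> xt yt; apply/negPn/negP => nc.
have ctt : tree_closed t by split=> // r; rewrite jt j't.
have [cA cB] := tree_closed_part x ctt.
have ltA := tree_count cA; have ltB := tree_count cB.
have /ltA {}ltA : [set z in t | connect tree_edge x z] != set0.
  by apply/set0Pn; exists x; rewrite inE xt connect0.
have /ltB {}ltB : t :\: [set z in t | connect tree_edge x z] != set0.
  by apply/set0Pn; exists y; rewrite !inE yt (negPf nc).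
have := leq_add ltA ltB; rewrite -{3}(setIidPr cA.1) cardsID ct addSn addnS !ltnS.
rewrite leqNgt => /negP[]; rewrite ltnS -cardsT.
rewrite -(cardsID [set r | j r \in [set z in t | connect tree_edge x z]]) setTI leq_add //.
by apply/subset_leq_card/subsetP => r; rewrite !inE jt /= andbT.
Qed.

End Tree.

(** As the linkage graph is connected, [fib_tree] confines all partners of [r] to the two ends of
    its edge. *)
Lemma linked_exchange :
  (forall t : {set L}, #|t| = #|R|.+1 -> forall r, exists x y, [/\ x \in t, y \in t, x != y &
     forall q, q != r -> fib F (t :\ x) q = fib F (t :\ y) q]) ->
  linked (fun=> 1) F.
Proof.
move=> exch; split=> // t; rewrite sum1_card => ct r.
have /fin_all_exists[u uP] r' : exists u : L * L, [/\ u.1 \in t, u.2 \in t, u.1 != u.2 &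
    forall q, q != r' -> fib F (t :\ u.1) q = fib F (t :\ u.2) q].
  by have [x [y xy]] := exch t ct r'; exists (x, y).
pose j r := (u r).1; pose j' r := (u r).2.
apply: (@leq_trans #|[set j r; j' r]|); last by rewrite cards2; case: (_ != _).
have jt q : j q \in t by case: (uP q).
have j't q : j' q \in t by case: (uP q).
have jj' q : j q != j' q by case: (uP q).
have agree q q' : q' != q -> fib F (t :\ j q) q' = fib F (t :\ j' q) q'.
  by case: (uP q) => _ _ _; apply.
apply/subset_leq_card/bigcupsP => x xt; apply: fib_tree => //.
apply: (@tree_connected t j j') => //.
Qed.

End Exchange.

(** * Equality of functions from acyclicity and from sections *)

Section Functions.
Variables L R : finType.
Implicit Types f g : L -> R.

(** Let [B] be the set of nodes reached from [g l]. The points of [J] with [f]-value in [B] are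
    mapped by [g] into [B], and by counting onto its part in the common image. Hence [l] is one of
    them, so [f l] is in [B] and the arc of [l] closes a cycle unless [f l = g l]. *)
Lemma no_cycle_eq_in f g (J : {set L}) :
  (forall r, ~~ fed (arcs predT f g) r) -> {in J &, injective f} -> {in J &, injective g} ->
  f @: J = g @: J -> {in J, f =1 g}.
Proof.
move=> nofed injf injg fg l lJ; apply/eqP; apply/negPn/negP => nfg.
set D := arcs predT f g in nofed.
pose B := [set b | connect D (g l) b]; pose JB := [set k in J | f k \in B].
have JBJ : JB \subset J by apply/subsetP => k; rewrite inE => /andP[].
have gB : g @: JB \subset B :&: (g @: J).
  apply/subsetP => _ /imsetP[k /setIdP[kJ fk] ->]; rewrite inE imset_f // andbT.
  by move: fk; rewrite !inE => /connect_trans; apply; apply: arcsI.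
have fB : f @: JB = B :&: (g @: J).
  rewrite -fg; apply/setP => b; apply/imsetP/setIP => [[k /setIdP[kJ fk] ->]|[bB /imsetP[k kJ bk]]].
    by rewrite imset_f.
  by exists k => //; rewrite inE kJ -bk.
have eqg : g @: JB = B :&: (g @: J).
  apply/eqP; rewrite eqEcard gB -fB (card_in_imset (sub_in2 (subsetP JBJ) injf)).
  by rewrite (card_in_imset (sub_in2 (subsetP JBJ) injg)) leqnn.
have : g l \in B :&: (g @: J) by rewrite !inE connect0 imset_f.
rewrite -eqg => /imsetP[k kJB glk].
have kl : l = k by apply: injg => //; apply: (subsetP JBJ).
move: kJB; rewrite -kl !inE lJ /= => gfl.
case/negP: (nofed (f l)); apply/fedP; exists (f l), (g l); split=> //.
exact: arcsI.
Qed.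

(* The section [h] of [f] picks a point moved by [f'] whenever the fibre contains
   one; then [f' \o h] has no fixed point on the set of nodes it moves, and
   permutes a minimal stable subset of it. *)
Lemma eq_of_sections f f' :
  (forall r, #|[set l | f l == r]| = #|[set l | f' l == r]|) ->
  (forall r, 0 < #|[set l | f l == r]|) ->
  (forall h : R -> L, cancel h f -> forall I : {set R}, {in I &, injective (f' \o h)} ->
     (f' \o h) @: I = I -> {in I, f' \o h =1 id}) ->
  f =1 f'.
Proof.
move=> eqc c0 sect.
have /fin_all_exists[h hP] r : exists l, f l = r /\
    (f' l != r \/ forall k, f k = r -> f' k = r).
  have [/existsP[l /andP[/eqP fl f'l]]|/existsPn no] :=
      boolP [exists l, (f l == r) && (f' l != r)].
    by exists l; split=> //; left.
  have [l] := card_gt0P (c0 r); rewrite inE => /eqP fl; exists l; split=> //; right.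
  by move=> k fk; have := no k; rewrite fk eqxx /= negbK => /eqP.
have hK : cancel h f by move=> r; case: (hP r).
pose p := f' \o h; pose Mv := [set r | p r != r].
have fixP n : p n = n -> forall k, f' k = n -> f k = n.
  move=> pn; have [_ [|all]] := hP n; first by rewrite [f' (h n)]pn eqxx.
  have sub : [set l | f l == n] \subset [set l | f' l == n].
    by apply/subsetP => k; rewrite !inE => /eqP/all ->.
  move=> k f'k; have : k \in [set l | f' l == n] by rewrite inE f'k.
  have -> : [set l | f' l == n] = [set l | f l == n].
    by apply/esym/eqP; rewrite eqEcard sub eqc leqnn.
  by rewrite inE => /eqP.
have stableMv : p @: Mv \subset Mv.
  apply/subsetP => _ /imsetP[r rM ->]; rewrite inE; apply/eqP => ppr.
  move: rM; rewrite inE => /negP[]; apply/eqP.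
  by rewrite -[RHS]hK (fixP _ ppr (h r)).
move=> l; apply/eqP; apply/negPn/negP => nl.
have Mv0 : Mv != set0.
  apply/set0Pn; exists (f l); rewrite inE; apply/negP => /eqP fixl.
  have [_ [|all]] := hP (f l); first by rewrite [f' (h _)]fixl eqxx.
  by rewrite (all l) ?eqxx in nl.
pose P (I : {set R}) := [&& I != set0, I \subset Mv & p @: I \subset I].
have [I minI] : {I | minset P I}.
  by apply: ex_minset; exists Mv; rewrite /P Mv0 subxx.
have /and3P[I0 IM pI] := minsetp minI.
have pII : p @: I = I.
  apply: (minsetinf minI) (pI); rewrite /P (subset_trans pI IM) imsetS ?andbT //=.
  by have [x xI] := set0Pn _ I0; apply/set0Pn; exists (p x); apply: imset_f.
have injp : {in I &, injective p} by apply/imset_injP; rewrite pII.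
have [x xI] := set0Pn _ I0; have := subsetP IM _ xI.
by rewrite inE [p x](sect h hK I injp pII) // eqxx.
Qed.

End Functions.

(** * Perfect matchings, graphs of functions, and the tope field of a matching field *)

Section Matchings.
Variables n d : nat.
Implicit Types (P : graph n d) (J : {set 'I_n}) (I : {set 'I_d}).

Lemma pm_left J I P l : perfect_matching J I P -> l \in J -> exists r, (l, r) \in P.
Proof.
move=> [_ left _] /left /eqP /cards1P[[l' r] PE].
have := set11 (l', r); rewrite -PE inE /= => /andP[lP /eqP <-].
by exists r.
Qed.

Lemma pm_right J I P r : perfect_matching J I P -> r \in I -> exists l, (l, r) \in P.
Proof.
move=> [_ _ right] /right /eqP /cards1P[[l r'] PE].
have := set11 (l, r'); rewrite -PE inE /= => /andP[lP /eqP <-].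
by exists l.
Qed.

Lemma pm_sub J I P l r : perfect_matching J I P -> (l, r) \in P -> l \in J /\ r \in I.
Proof. by move=> [sub _ _] /sub /andP. Qed.

Lemma pm_eql J I P l r r' : perfect_matching J I P ->
  (l, r) \in P -> (l, r') \in P -> r = r'.
Proof.
move=> pm lr lr'; have [lJ _] := pm_sub pm lr; case: pm => _ /(_ l lJ) /eqP /cards1P[x eqx] _.
have : (l, r) \in [set x] by rewrite -eqx inE lr eqxx.
have : (l, r') \in [set x] by rewrite -eqx inE lr' eqxx.
by rewrite !in_set1 => /eqP <- /eqP[].
Qed.

Lemma pm_eqr J I P l l' r : perfect_matching J I P ->
  (l, r) \in P -> (l', r) \in P -> l = l'.
Proof.
move=> pm lr lr'; have [_ rI] := pm_sub pm lr; case: pm => _ _ /(_ r rI) /eqP /cards1P[x eqx].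
have : (l, r) \in [set x] by rewrite -eqx inE lr eqxx.
have : (l', r) \in [set x] by rewrite -eqx inE lr' eqxx.
by rewrite !in_set1 => /eqP <- /eqP[].
Qed.

Lemma perfect_matching_imset (h : 'I_d -> 'I_n) (p : 'I_d -> 'I_d) I :
  injective h -> {in I &, injective p} -> p @: I = I ->
  perfect_matching (h @: I) I [set (h r, p r) | r in I].
Proof.
move=> injh injp pI; split=> [e /imsetP[r rI ->]|l /imsetP[r rI ->]|q qI].
- by rewrite /= imset_f //=; have := imset_f p rI; rewrite pI.
- apply/eqP/cards1P; exists (h r, p r); apply/setP => e; rewrite !inE.
  apply/andP/eqP => [[/imsetP[q qI ->] /eqP /= /injh -> //]|->].
  by rewrite eqxx; split=> //; apply/imsetP; exists r.
have /imsetP[r rI ->] : q \in p @: I by rewrite pI.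
apply/eqP/cards1P; exists (h r, p r); apply/setP => e; rewrite !inE.
apply/andP/eqP => [[/imsetP[q' q'I ->] /eqP /= /injp -> //]|->].
by rewrite eqxx; split=> //; apply/imsetP; exists r.
Qed.

Definition graph_of (f : 'I_n -> 'I_d) : graph n d := [set e | f e.1 == e.2].

Lemma ldeg_graph_of f l : ldeg (graph_of f) l = 1.
Proof.
apply/eqP/cards1P; exists (l, f l); apply/setP => -[k r]; rewrite !inE xpair_eqE /=.
by case: (eqVneq k l) => [->|]; rewrite ?andbF ?andbT // eq_sym.
Qed.

Lemma rdeg_graph_of f r : rdeg (graph_of f) r = #|[set l | f l == r]|.
Proof.
rewrite -(card_imset _ (fun x y (e : (x, r) = (y, r)) => congr1 fst e)).
apply: eq_card => -[k q]; rewrite !inE /=; apply/andP/imsetP.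
  by move=> [/eqP fk /eqP qr]; exists k; [rewrite inE fk qr | rewrite qr].
by move=> [l]; rewrite inE => /eqP fl [-> ->]; rewrite fl !eqxx.
Qed.

Lemma graph_of_ldeg P : (forall l, ldeg P l = 1) -> exists f, P = graph_of f.
Proof.
move=> dP; have /fin_all_exists[f fP] l : exists r, forall q, ((l, q) \in P) = (r == q).
  have /eqP /cards1P[[l' r] PE] := dP l; have := set11 (l', r).
  rewrite -PE inE /= => /andP[_ /eqP e]; subst l'; exists r => q.
  by move/setP/(_ (l, q)): PE; rewrite !inE xpair_eqE !eqxx andbT /= eq_sym => ->.
by exists f; apply/setP => -[l r]; rewrite fP inE.
Qed.

End Matchings.

Section Mates.
Variables n d : nat.
Variable M : {set 'I_n} -> graph n d.+1.
Hypothesis MM : matching_field M.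

(** For a matching field the default [ord0] is never taken when [l] lies in a set [s] of [d.+1]
    points. *)
Definition mate s l : 'I_d.+1 := odflt ord0 [pick r | (l, r) \in M s].

Lemma mateE (s : {set 'I_n}) l r : #|s| = d.+1 -> l \in s -> ((l, r) \in M s) = (mate s l == r).
Proof.
move=> /MM pm ls; rewrite /mate; case: pickP => [q lq|no] /=.
  by apply/idP/eqP => [/(pm_eql pm lq)|<-].
by have [q] := pm_left pm ls; rewrite no.
Qed.

Lemma fib_mate (s : {set 'I_n}) l r : #|s| = d.+1 -> (l \in fib mate s r) = ((l, r) \in M s).
Proof.
move=> cs; rewrite inE; case: (boolP (l \in s)) => [ls|ls] /=; first by rewrite mateE.
by apply/esym; apply: contraNF ls => /(pm_sub (MM cs))[].
Qed.

Lemma linked_mate : linkage M -> linked (fun=> 1) mate.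
Proof.
move=> linkM; apply: linked_exchange => [s|t].
  rewrite sum1_card card_ord => cs r; have [l lr] := pm_right (MM cs) (in_setT r).
  apply/eqP/cards1P; exists l; apply/setP => k; rewrite fib_mate // inE.
  by apply/idP/eqP => [kr|->//]; apply: pm_eqr (MM cs) kr lr.
rewrite card_ord => ct r; have [x [y [xt yt xy /setP eq]]] := linkM r t ct.
have cd z : z \in t -> #|t :\ z| = d.+1.
  by move=> zt; have := cardsD1 z t; rewrite zt ct add1n => -[].
exists x, y; split=> // q qr; apply/setP => l; rewrite !fib_mate ?cd //.
by have := eq (l, q); rewrite !inE /= qr !andbT.
Qed.

End Mates.

Lemma exists_counts (R : finType) (c : R -> nat) : exists s : seq R, forall r, count_mem r s = c r.
Proof.
exists (flatten [seq nseq (c r) r | r <- enum R]) => r.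
rewrite count_flatten -map_comp sumnE big_map big_enum /= (bigD1 r) //= count_nseq /= eqxx mul1n.
by rewrite big1 ?addn0 // => q /negPf qr; rewrite count_nseq /= qr.
Qed.

Theorem theorem3p16 (n d : nat) (M : {set 'I_n} -> graph n d) :
  d <= n -> matching_field M -> linkage M ->
  forall v : 'I_d -> nat,
    (forall i, 0 < v i) -> \sum_(i < d) v i = n ->
    exists F : graph n d,
      [/\ maximal_tope F, (forall i, rdeg F i = v i), compatible_with_field M F &
          forall F' : graph n d,
            maximal_tope F' -> (forall i, rdeg F' i = v i) ->
            compatible_with_field M F' -> F' = F].
Proof.
case: d M => [|d] M _ MM linkM v v_gt0 sumv.
  (* With no right nodes the degree sum forces [n = 0], and every graph is empty. *)
  have n0 : n = 0 by rewrite -sumv big_ord0.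
  have eqG (F G : graph n 0) : F = G by apply/setP => -[? []].
  exists set0; split=> [|[]//|s cs J I P1 P2 _ _ _ _|F _ _ _] //.
  by split=> [l|[]//]; exfalso; move: l; rewrite n0 => -[].
have lF := linked_mate MM linkM.
(* The matching field already gives every node degree 1, so [(v r).-1] amalgamations over [r]
   remain. *)
have [s cs] := exists_counts (fun r => (v r).-1).
have vE r : v r = (count_mem r s).+1 by rewrite cs prednK.
have sz : #|'I_n| = #|'I_d.+1| + size s.
  rewrite card_ord -[in LHS]sumv -sum_count_mem -sum1_card -big_split /=.
  by apply: eq_bigr => r _; rewrite vE.
pose f := amalgs (mate M) s setT.
have cf r : #|[set l | f l == r]| = v r.
  have [_ fF _] := linked_amalgs s lF; have := fF setT _ r.
  rewrite sum_incrs incrsE sum1_card cardsT add1n -vE => <- //.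
  by apply: eq_card => l; rewrite !inE.
have compF : compatible_with_field M (graph_of f).
  move=> t ct J I P1 P2 pm1 P1f pm2 P2M.
  (* The matching [M t] is extended to a tope [g], so that acyclicity can be applied to [f] and
     [g]. *)
  have [||s' cs' eqs'] := @amalgs_extend _ _ _ _ lF [::] t.
  - by rewrite -card_gt0 ct.
  - by rewrite /= sum1_card card_ord addn0.
  rewrite /= sum1_card in cs'; pose g := amalgs (mate M) s' setT.
  have Jt l : l \in J -> l \in t.
    by move=> /(pm_left pm2)[r /(subsetP P2M)] /(pm_sub (MM t ct))[].
  have fE l r : (l, r) \in P1 -> f l = r by move/(subsetP P1f); rewrite inE => /eqP.
  have gE l r : (l, r) \in P2 -> g l = r.
    move=> lr; have [/Jt lt _] := pm_sub pm2 lr; rewrite /g -eqs' //.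
    by move/(subsetP P2M): lr; rewrite mateE // => /eqP.
  have onto h P : perfect_matching J I P -> (forall l r, (l, r) \in P -> h l = r) ->
      {in J &, injective h} /\ h @: J = I.
    move=> pm hE; split=> [a b aJ bJ ab|].
      have [r ar] := pm_left pm aJ; have [q bq] := pm_left pm bJ.
      by apply: (pm_eqr pm ar); rewrite -(hE _ _ ar) ab (hE _ _ bq).
    apply/setP => r; apply/imsetP/idP => [[l /(pm_left pm)[q lq] ->]|/(pm_right pm)[l lr]].
      by rewrite (hE _ _ lq); case: (pm_sub pm lq).
    by exists l; [case: (pm_sub pm lr) | rewrite (hE _ _ lr)].
  have [injf fJ] := onto f P1 pm1 fE; have [injg gJ] := onto g P2 pm2 gE.
  have fg : {in J, f =1 g}.
    apply: no_cycle_eq_in injf injg _; last by rewrite fJ gJ.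
    exact: amalgs_no_cycle.
  apply/setP => -[l r]; apply/idP/idP => lr.
    have [lJ _] := pm_sub pm1 lr; have [q lq] := pm_left pm2 lJ.
    by rewrite -(fE _ _ lr) fg // (gE _ _ lq).
  have [lJ _] := pm_sub pm2 lr; have [q lq] := pm_left pm1 lJ.
  by rewrite -(gE _ _ lr) -fg // (fE _ _ lq).
exists (graph_of f); split=> // [|r|F' [/graph_of_ldeg[f' ->] _] degF' compF'].
- by split=> [l|r]; rewrite ?ldeg_graph_of // rdeg_graph_of cf.
- by rewrite rdeg_graph_of.
suff eqf : f =1 f' by apply/setP => -[l r]; rewrite !inE /= eqf.
apply: eq_of_sections => [r|r|h hK I injp pI r rI]; rewrite ?cf //.
  by rewrite -rdeg_graph_of degF'.
have injh : injective h := can_inj hK.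
have ct : #|h @: [set: 'I_d.+1]| = d.+1 by rewrite card_imset // cardsT card_ord.
(* The section [h] of [f] and the matching of the field on its image join the same nodes, so
   compatibility identifies them. *)
have hM : [set (h q, q) | q in [set: 'I_d.+1]] = M (h @: setT).
  apply: (compF _ ct) (MM _ ct) _ => //; last first.
    by apply/subsetP => _ /imsetP[q _ ->]; rewrite inE /= hK.
  by apply: (perfect_matching_imset (p := id)); rewrite ?imset_id.
(* On [h @: I] the function [f'] gives a second matching onto [I], which compatibility of [F'] with
   the field identifies with the section. *)
have eqI : [set (h q, (f' \o h) q) | q in I] = [set (h q, q) | q in I].
  apply: (compF' _ ct (h @: I) I); first exact: perfect_matching_imset.
  - by apply/subsetP => _ /imsetP[q _ ->]; rewrite inE /=.
  - by apply: (perfect_matching_imset (p := id)); rewrite ?imset_id.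
  - by rewrite -hM imsetS // subsetT.
have : (h r, (f' \o h) r) \in [set (h r, r) | r in I].
  by rewrite -eqI; apply/imsetP; exists r.
by case/imsetP=> q _ [/injh <- ].
Qed.
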